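(* There exist Eulerian posets whose Chow polynomial and augmented Chow polynomials have negative coefficients.
   Context: Posets are finite, bounded (with minimum $\widehat 0$ and maximum $\widehat 1$) and graded with rank function $\rho$ (length of maximal chains from $\widehat 0$); $\rho_{st}=\rho(t)-\rho(s)$. A poset $P$ is Eulerian if its Möbius function satisfies $\mu_{st}=(-1)^{\rho_{st}}$ for all $s\le t$. Incidence algebra: $\mathcal I(P)$ consists of functions $a$ assigning to each closed interval $[s,t]$ a polynomial $a_{st}(x)\in\mathbb Z[x]$, with product $(ab)_{st}=\sum_{s\le w\le t}a_{sw}b_{wt}$. $\mathcal I_\rho(P)$ is the subalgebra of those $a$ with $\deg a_{st}\le\rho_{st}$, and $a^{\mathrm{rev}}_{st}(x)=x^{\rho_{st}}a_{st}(x^{-1})$. For $P$ Eulerian, the Eulerian kernel is $\varepsilon_{st}=(x-1)^{\rho_{st}}$. The right Kazhdan–Lusztig–Stanley (KLS) function $f$ and left KLS function $g$ are the unique elements of $\mathcal I_\rho(P)$ with $f_{ss}=g_{ss}=1$, $\deg f_{st},\deg g_{st}<\tfrac12\rho_{st}$ for $s<t$, and $f^{\mathrm{rev}}=\varepsilon f$, $g^{\mathrm{rev}}=g\,\varepsilon$. Let $\overline\varepsilon_{st}=(x-1)^{\rho_{st}-1}$ for $s<t$, $\overline\varepsilon_{ss}=-1$, and set $\mathrm H=-(\overline\varepsilon)^{-1}$, $F=\mathrm H\cdot f^{\mathrm{rev}}$, $G=g^{\mathrm{rev}}\cdot\mathrm H$. The Chow polynomial of $P$ is $\mathrm H_P=\mathrm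 H_{\widehat 0\widehat 1}$, and the augmented Chow polynomials of $P$ are the right augmented Chow polynomial $F_P=F_{\widehat 0\widehat 1}$ and the left augmented Chow polynomial $G_P=G_{\widehat 0\widehat 1}$ (all with respect to the Eulerian kernel). *)

(* Defs.v *)
From mathcomp Require Import all_boot all_order all_algebra.

Set Implicit Arguments.
Unset Strict Implicit.
Unset Printing Implicit Defensive.

Import Order.TTheory GRing.Theory Num.Theory.
Local Open Scope ring_scope.

Section ChowPolynomials.

Variables (d : Order.disp_t) (P : finTBPOrderType d).

Definition covers (s t : P) : bool :=
  (s < t)%O && [forall w : P, ~~ ((s < w)%O && (w < t)%O)].

(* The saturated chains \bot = s_0 < s_1 < ... < s_k = t are the maximal chains
   of [\bot, t]; they must all have length k = rho t. As P is finite such chains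
   exist for every t, so P is graded iff such a rho exists, and rho is unique. *)
Definition rank_function (rho : P -> nat) : Prop :=
  forall p : seq P, path covers \bot%O p -> rho (last \bot%O p) = size p.

(* An element of the incidence algebra I(P) is represented by a function of two
   arguments whose values at pairs (s, t) with ~~ (s <= t) are irrelevant:
   equality in I(P) is eq_inc, and the product never reads those values. *)
Definition incidence := P -> P -> {poly int}.

Implicit Types (a b : incidence).

Definition eq_inc a b : Prop := forall s t : P, (s <= t)%O -> a s t = b s t.

Definition mul_inc a b : incidence :=
  fun s t => \sum_(w : P | (s <= w)%O && (w <= t)%O) a s w * b w t.

Definition one_inc : incidence := fun s t => (s == t)%:R.

Definition opp_inc a : incidence := fun s t => - a s t.

Definition inverse_inc a b : Prop :=
  eq_inc (mul_inc a b) one_inc /\ eq_inc (mul_inc b a) one_inc.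

Definition zeta : incidence := fun _ _ => 1.

Definition mobius_function (mu : incidence) : Prop := inverse_inc zeta mu.

Variable rho : P -> nat.

(* Only used for s <= t, where the truncated subtraction is the usual one. *)
Definition rk (s t : P) : nat := (rho t - rho s)%N.

Definition eulerian : Prop :=
  exists2 mu : incidence, mobius_function mu &
    forall s t : P, (s <= t)%O -> mu s t = (-1) ^+ rk s t.

Definition in_Irho a : Prop :=
  forall s t : P, (s <= t)%O -> (size (a s t) <= (rk s t).+1)%N.

(* x^{rk s t} * a_{st}(1/x), for a in I_rho(P). *)
Definition rev_inc a : incidence :=
  fun s t => \poly_(i < (rk s t).+1) (a s t)`_(rk s t - i).

Definition eulerian_kernel : incidence := fun s t => ('X - 1) ^+ rk s t.

(* For s < t the degree of a s t is (size (a s t)).-1, also when a s t = 0 since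
   then rk s t > 0 and the condition holds either way. *)
Definition kls_normalized a : Prop :=
  [/\ in_Irho a,
      forall s : P, a s s = 1 &
      forall s t : P, (s < t)%O -> (2 * (size (a s t)).-1 < rk s t)%N].

Definition right_kls (f : incidence) : Prop :=
  kls_normalized f /\ eq_inc (rev_inc f) (mul_inc eulerian_kernel f).

Definition left_kls (g : incidence) : Prop :=
  kls_normalized g /\ eq_inc (rev_inc g) (mul_inc g eulerian_kernel).

Definition reduced_kernel : incidence :=
  fun s t => if s == t then -1 else ('X - 1) ^+ (rk s t).-1.

(* H = - (reduced_kernel)^-1, i.e. - H is the inverse of the reduced kernel. *)
Definition chow_function (H : incidence) : Prop :=
  inverse_inc reduced_kernel (opp_inc H).

Definition chow_polynomial (p : {poly int}) : Prop :=
  exists2 H, chow_function H & p = H \bot%O \top%O.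

Definition right_augmented_chow_polynomial (p : {poly int}) : Prop :=
  exists H f, [/\ chow_function H, right_kls f &
                  p = mul_inc H (rev_inc f) \bot%O \top%O].

Definition left_augmented_chow_polynomial (p : {poly int}) : Prop :=
  exists H g, [/\ chow_function H, left_kls g &
                  p = mul_inc (rev_inc g) H \bot%O \top%O].

End ChowPolynomials.

Definition has_negative_coefficient (p : {poly int}) : Prop :=
  exists i : nat, p`_i < 0.

(* Main.v *)
Require Import Defs.
From Stdlib Require Import BinInt.
From mathcomp Require Import all_boot all_order all_algebra.
From HB Require Import structures.
From mathcomp Require Import zify ssrZ.

Set Implicit Arguments.
Unset Strict Implicit.
Unset Printing Implicit Defensive.

Import Order.TTheory GRing.Theory Num.Theory.
Local Open Scope ring_scope.

(** The example is a poset of rank 11 in which every rank r with 0 < r < 11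
    carries several labels.  It is described by bands: a band is an interval of
    ranks with a number of colours; an element of rank r carries one colour for
    each band containing r, and s < t means that s has smaller rank than t and
    that the two colours agree for every band containing both ranks.  The
    singleton bands {r} have 2 colours, and the bands [1,4], [3,8], [7,10] have
    N = 300 colours each.

    In such a poset, the number of elements of rank r in [s, t] is the product
    of the numbers of colours of the bands that contain r but neither rank s nor
    rank t ([card_rank_band]): it depends on the three ranks only.  The rank
    counts alternate to 0 in every nontrivial interval, because the singleton
    bands put two elements wherever a chain has one, and because the other bands
    and their intersections have even length, so that the contributions of N
    cancel in pairs; similar posets occur in the work of Bayer and Hetyei on flag
    vectors of half-Eulerian posets.

    Why the coefficients are negative: with M = N - 1, the flag numbers are
    polynomials in M, and so are the coefficients of the Chow polynomials.  The
    coefficient of M^3 comes from the chains that meet all three long bands; by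
    inclusion-exclusion, crossing bands give it negative terms.  For x^4 it is
    -48 in H_P and -4 in F_P.  Since -4 has to win against the terms of
    lower degree in M, M is taken of the order of hundreds.  Reversing the ranks
    maps the family of bands to itself, so P is self-dual and G_P = F_P.

    As the rank counts depend on ranks only, the functions that depend on ranks
    only form a subalgebra of the incidence algebra, isomorphic to an algebra of
    12 x 12 matrices of polynomials with a twisted product ([mul_rm_inc]).  The
    Moebius function, the Chow function and the two KLS functions all lie in it.
    They are found there by their defining recursions, and the
    identities that characterize them are verified by computation in that matrix
    algebra ([bands11_check]); the recursions themselves are not reasoned about.
    Coefficients are binary integers, since they exceed 10^10. *)

(** * Integer polynomials as coefficient lists *)

Local Notation Z1 := (Zpos xH).
Local Notation ZN1 := (Zneg xH).

Definition zpoly := seq Z.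

Fixpoint zpoly_add (p q : zpoly) : zpoly :=
  match p, q with
  | a :: p', b :: q' => Z.add a b :: zpoly_add p' q'
  | [::], _ => q
  | _, [::] => p
  end.

Definition zpoly_scale (a : Z) (p : zpoly) : zpoly := map (Z.mul a) p.

Fixpoint zpoly_mul (p q : zpoly) : zpoly :=
  if p is a :: p' then zpoly_add (zpoly_scale a q) (Z0 :: zpoly_mul p' q)
  else [::].

Definition zpoly_Xsub1_exp (k : nat) : zpoly :=
  iter k (zpoly_mul [:: ZN1; Z1]) [:: Z1].

Definition zpoly_rev (d : nat) (p : zpoly) : zpoly :=
  mkseq (fun i => nth Z0 p (d - i)) d.+1.

(** Lists may end with zeros, so equality of polynomials is not equality of
    lists. *)
Definition zpoly_eq (p q : zpoly) : bool :=
  all (Z.eqb Z0) (zpoly_add p (zpoly_scale ZN1 q)).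

Definition zpoly_sum (s : seq nat) (F : nat -> zpoly) : zpoly :=
  foldr (fun r => zpoly_add (F r)) [::] s.

Definition zpoly_val (p : zpoly) : {poly int} := Poly (map int_of_Z p).

Lemma zpoly_val0 : zpoly_val [::] = 0.
Proof. by []. Qed.

Lemma zpoly_val_cons a p :
  zpoly_val (a :: p) = zpoly_val p * 'X + (int_of_Z a)%:P.
Proof. by rewrite /zpoly_val /= cons_poly_def. Qed.

Lemma coef_zpoly_val p k : (zpoly_val p)`_k = int_of_Z (nth Z0 p k).
Proof.
rewrite /zpoly_val coef_Poly; have [lt_kp|le_pk] := ltnP k (size p).
  by rewrite (nth_map Z0).
by rewrite !nth_default ?size_map.
Qed.

Lemma size_zpoly_val p : (size (zpoly_val p) <= size p)%N.
Proof. by rewrite -(size_map int_of_Z); apply: size_Poly. Qed.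

Lemma zpoly_val_add p q :
  zpoly_val (zpoly_add p q) = zpoly_val p + zpoly_val q.
Proof.
elim: p q => [|a p IHp] [|b q]; rewrite /= ?zpoly_val0 ?addr0 ?add0r //.
rewrite !zpoly_val_cons IHp (rmorphD int_of_Z a b) polyCD mulrDl.
by rewrite addrACA.
Qed.

Lemma zpoly_val_scale a p :
  zpoly_val (zpoly_scale a p) = (int_of_Z a)%:P * zpoly_val p.
Proof.
elim: p => [|b p IHp]; first by rewrite zpoly_val0 mulr0.
rewrite /= !zpoly_val_cons -/(zpoly_scale a p) IHp.
by rewrite (rmorphM int_of_Z a b) polyCM mulrDr mulrA.
Qed.

Lemma zpoly_val_mul p q :
  zpoly_val (zpoly_mul p q) = zpoly_val p * zpoly_val q.
Proof.
elim: p => [|a p IHp]; first by rewrite zpoly_val0 mul0r.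
rewrite /= zpoly_val_add zpoly_val_scale !zpoly_val_cons IHp addr0 mulrDl.
by rewrite addrC mulrAC.
Qed.

Lemma zpoly_val1 : zpoly_val [:: Z1] = 1.
Proof. by rewrite zpoly_val_cons zpoly_val0 mul0r add0r. Qed.

Lemma zpoly_valN1 : zpoly_val [:: ZN1] = -1.
Proof. by rewrite zpoly_val_cons zpoly_val0 mul0r add0r -polyCN. Qed.

Lemma zpoly_val_Xsub1_exp k : zpoly_val (zpoly_Xsub1_exp k) = ('X - 1) ^+ k.
Proof.
elim: k => [|k IHk]; first exact: zpoly_val1.
rewrite /zpoly_Xsub1_exp iterS -/(zpoly_Xsub1_exp k) zpoly_val_mul IHk exprS.
by congr (_ * _); rewrite zpoly_val_cons zpoly_val1 mul1r (_ : int_of_Z ZN1 = - 1) // polyCN.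
Qed.

Lemma zpoly_val_rev d p :
  zpoly_val (zpoly_rev d p) = \poly_(i < d.+1) (zpoly_val p)`_(d - i).
Proof.
apply/polyP=> k; rewrite coef_zpoly_val coef_poly.
have [lt_kd|le_dk] := ltnP k d.+1; first by rewrite nth_mkseq // coef_zpoly_val.
by rewrite nth_default // size_mkseq.
Qed.

Lemma zpoly_val_sum s F :
  zpoly_val (zpoly_sum s F) = \sum_(r <- s) zpoly_val (F r).
Proof.
elim: s => [|r s IHs]; first by rewrite big_nil.
by rewrite big_cons /= zpoly_val_add -IHs.
Qed.

Lemma zpoly_eqP p q : zpoly_eq p q -> zpoly_val p = zpoly_val q.
Proof.
move=> /allP p0; apply/eqP; rewrite -subr_eq0 -mulN1r.
have -> : -1 = (int_of_Z ZN1)%:P :> {poly int} by rewrite (_ : int_of_Z ZN1 = - 1) // polyCN.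
rewrite -zpoly_val_scale -zpoly_val_add; apply/eqP/polyP=> k.
rewrite coef0 coef_zpoly_val; set u := zpoly_add _ _ in p0 *.
have [lt_ku|le_uk] := ltnP k (size u); last by rewrite nth_default.
by have := p0 _ (mem_nth Z0 lt_ku) => /Z.eqb_spec <-.
Qed.

(** * Rank-uniform posets *)

Lemma partition_big_uniq_seq (V : nmodType) (I : finType) (J : eqType)
    (Q : pred I) (p : I -> J) (s : seq J) (F : I -> V) :
    uniq s -> (forall i, Q i -> p i \in s) ->
  \sum_(i | Q i) F i = \sum_(j <- s) \sum_(i | Q i && (p i == j)) F i.
Proof.
move=> uniq_s Qs; rewrite (exchange_big_dep Q) => [|j i _ /andP[]//].
apply: eq_bigr => i Qi; rewrite Qi.
under eq_bigl do rewrite eq_sym.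
by rewrite -big_filter (@filter_pred1_uniq _ s (p i)) ?Qs // big_seq1.
Qed.

(** A function on pairs of ranks; only pairs (i, j) with i <= j matter. *)
Definition rank_matrix := nat -> nat -> zpoly.

Section RankMatrices.

Variables (n : nat) (cnt : nat -> nat -> nat -> Z).

(** The product of the incidence algebra, when [cnt i r j] is the number of
    elements of rank r in an interval whose ends have ranks i and j. *)
Definition rm_mul (A B : rank_matrix) : rank_matrix := fun i j =>
  zpoly_sum (iota i (j - i).+1)
    (fun r => zpoly_scale (cnt i r j) (zpoly_mul (A i r) (B r j))).

Definition rm_eq (A B : rank_matrix) : bool :=
  all (fun j => all (fun i => zpoly_eq (A i j) (B i j)) (iota 0 j.+1))
      (iota 0 n.+1).

Definition rm_one : rank_matrix := fun i j => if i == j then [:: Z1] else [::].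

Definition rm_zeta : rank_matrix := fun _ _ => [:: Z1].

Definition rm_mobius : rank_matrix := fun i j =>
  [:: if odd (j - i) then ZN1 else Z1].

Definition rm_kernel : rank_matrix := fun i j => zpoly_Xsub1_exp (j - i).

Definition rm_reduced_kernel : rank_matrix := fun i j =>
  if i == j then [:: ZN1] else zpoly_Xsub1_exp (j - i).-1.

Definition rm_opp (A : rank_matrix) : rank_matrix :=
  fun i j => zpoly_scale ZN1 (A i j).

Definition rm_rev (A : rank_matrix) : rank_matrix :=
  fun i j => zpoly_rev (j - i) (A i j).

(** Column j, listed from row j - k to row j.  In the recursions below, row
    i < j of a column with diagonal entry 1 is obtained from the rows
    i + 1, ..., j of the same column; keeping the column as a list avoids recomputing them, which
    would take exponential time. *)
Fixpoint rm_column (step : nat -> nat -> (nat -> zpoly) -> zpoly) (k j : nat) :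
    seq zpoly :=
  if k is k'.+1 then
    let c := rm_column step k' j in
    (* c starts at row j - k', so that row r is its item r - (j - k') *)
    step (j - k)%N j (fun r => nth [::] c (r - (j - k'))) :: c
  else [:: [:: Z1]].

Definition rm_solve (step : nat -> nat -> (nat -> zpoly) -> zpoly) :
    rank_matrix :=
  let columns := mkseq (fun j => rm_column step j j) n.+1 in
  fun i j => nth [::] (nth [::] columns j) i.

(** The relation (reduced kernel) * H = -1, solved for its term r = i, where
    the reduced kernel is -1. *)
Definition rm_chow : rank_matrix := rm_solve (fun i j H =>
  zpoly_sum (iota i.+1 (j - i)) (fun r =>
    zpoly_scale (cnt i r j) (zpoly_mul (zpoly_Xsub1_exp (r - i).-1) (H r)))).

(** The relation f^rev = (kernel) * f, without its term r = i, gives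
    f^rev - f; as f has degree less than half the rank, f is the opposite of the
    lower half of that difference. *)
Definition rm_right_kls : rank_matrix := rm_solve (fun i j f =>
  take (j - i).+1./2%N (zpoly_scale ZN1
    (zpoly_sum (iota i.+1 (j - i)) (fun r =>
      zpoly_scale (cnt i r j) (zpoly_mul (zpoly_Xsub1_exp (r - i)) (f r)))))).

(** The left KLS function of P is the right KLS function of the dual of P: this
    is the correct candidate when the counts are invariant under
    (i, r, j) |-> (n - j, n - r, n - i). *)
Definition rm_left_kls : rank_matrix :=
  let f := rm_right_kls in fun i j => f (n - j)%N (n - i)%N.

Definition rm_kls_normalized (A : rank_matrix) : bool :=
  all (fun j => (A j j == [:: Z1]) &&
         all (fun i => (2 * (size (A i j)).-1 < j - i)%N) (iota 0 j))
      (iota 0 n.+1).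

(** The matrices above are proposals, and these conditions are all that is used
    of them, apart from the values at (0, n). *)
Definition rm_check : bool :=
  [&& rm_eq (rm_mul rm_zeta rm_mobius) rm_one &
      rm_eq (rm_mul rm_mobius rm_zeta) rm_one] &&
  [&& rm_eq (rm_mul rm_reduced_kernel (rm_opp rm_chow)) rm_one &
      rm_eq (rm_mul (rm_opp rm_chow) rm_reduced_kernel) rm_one] &&
  [&& rm_kls_normalized rm_right_kls &
      rm_eq (rm_rev rm_right_kls) (rm_mul rm_kernel rm_right_kls)] &&
  [&& rm_kls_normalized rm_left_kls &
      rm_eq (rm_rev rm_left_kls) (rm_mul rm_left_kls rm_kernel)].

Variables (d : Order.disp_t) (P : finTBPOrderType d) (rho : P -> nat).
Hypothesis rho_le_n : forall s, (rho s <= n)%N.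
Hypothesis rho_lt : forall s t : P, (s < t)%O -> (rho s < rho t)%N.
Hypothesis card_rank : forall (s t : P) r,
  (s <= t)%O -> (rho s <= r <= rho t)%N ->
  #|[set w : P | (s <= w <= t)%O && (rho w == r)]|%:Z =
  int_of_Z (cnt (rho s) r (rho t)).

Lemma rho_le (s t : P) : (s <= t)%O -> (rho s <= rho t)%N.
Proof. by rewrite le_eqVlt => /predU1P[->|/rho_lt/ltnW]. Qed.

Definition rm_inc (A : rank_matrix) : incidence P :=
  fun s t => zpoly_val (A (rho s) (rho t)).

Lemma eq_rho (s t : P) : (s <= t)%O -> (s == t) = (rho s == rho t).
Proof.
rewrite le_eqVlt => /predU1P[->|lt_st]; first by rewrite !eqxx.
by rewrite (lt_eqF lt_st) (ltn_eqF (rho_lt lt_st)).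
Qed.

Lemma eq_mul_inc (a a' b b' : incidence P) :
  eq_inc a a' -> eq_inc b b' -> eq_inc (mul_inc a b) (mul_inc a' b').
Proof.
move=> eq_a eq_b s t _; apply: eq_bigr => w /andP[le_sw le_wt].
by rewrite eq_a ?eq_b.
Qed.

(** The reduction of the incidence algebra to rank matrices: group the terms of
    a product by the rank of the middle element. *)
Lemma mul_rm_inc A B :
  eq_inc (mul_inc (rm_inc A) (rm_inc B)) (rm_inc (rm_mul A B)).
Proof.
move=> s t le_st; rewrite /mul_inc /rm_inc /rm_mul zpoly_val_sum.
rewrite (partition_big_uniq_seq (p := rho) _
          (iota_uniq (rho s) (rho t - rho s).+1)); last first.
  by move=> w /andP[/rho_le le_sw /rho_le le_wt]; rewrite mem_iota; lia.
rewrite big_seq [RHS]big_seq; apply: eq_bigr => r; rewrite mem_iota => r_in.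
rewrite zpoly_val_scale zpoly_val_mul.
have r_bnd : (rho s <= r <= rho t)%N by have := rho_le le_st; lia.
rewrite -card_rank //.
rewrite (eq_bigr (fun=> zpoly_val (A (rho s) r) * zpoly_val (B r (rho t)))).
  rewrite sumr_const -mulr_natl; congr (_ * _).
  rewrite -[in RHS]natz polyCMn polyC1; congr (_%:R).
  by apply: eq_card => w; rewrite !inE.
by move=> w /andP[_ /eqP ->].
Qed.

Lemma rm_eqP A B : rm_eq A B -> eq_inc (rm_inc A) (rm_inc B).
Proof.
move=> /allP eqAB s t le_st; apply: zpoly_eqP.
have t_in : rho t \in iota 0 n.+1 by rewrite mem_iota ltnS rho_le_n.
by have /allP := eqAB _ t_in; apply; rewrite mem_iota ltnS rho_le.
Qed.

Lemma rm_mulP (a b c : incidence P) A B C :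
    eq_inc a (rm_inc A) -> eq_inc b (rm_inc B) -> eq_inc c (rm_inc C) ->
  rm_eq (rm_mul A B) C -> eq_inc (mul_inc a b) c.
Proof.
move=> aA bB cC /rm_eqP ABC s t le_st.
by rewrite (eq_mul_inc aA bB) // mul_rm_inc // ABC // cC.
Qed.

Lemma rm_inc_one : eq_inc (@one_inc _ P) (rm_inc rm_one).
Proof.
move=> s t le_st; rewrite /one_inc /rm_inc /rm_one eq_rho //.
by case: eqP => _; rewrite ?zpoly_val1.
Qed.

Lemma rm_inc_reduced_kernel :
  eq_inc (reduced_kernel rho) (rm_inc rm_reduced_kernel).
Proof.
move=> s t le_st; rewrite /reduced_kernel /rm_inc /rm_reduced_kernel eq_rho //.
by case: eqP => _; rewrite ?zpoly_valN1 // zpoly_val_Xsub1_exp.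
Qed.

Lemma rm_inc_kernel : eq_inc (eulerian_kernel rho) (rm_inc rm_kernel).
Proof. by move=> s t _; rewrite /rm_inc zpoly_val_Xsub1_exp. Qed.

Lemma rm_inc_rev A : eq_inc (rev_inc rho (rm_inc A)) (rm_inc (rm_rev A)).
Proof. by move=> s t _; rewrite /rm_inc zpoly_val_rev. Qed.

Lemma rm_inc_opp A : eq_inc (opp_inc (rm_inc A)) (rm_inc (rm_opp A)).
Proof.
by move=> s t _; rewrite /rm_inc zpoly_val_scale (_ : int_of_Z ZN1 = - 1) // polyCN mulN1r.
Qed.

Lemma rm_kls_normalizedP A :
  rm_kls_normalized A -> kls_normalized rho (rm_inc A).
Proof.
move=> /allP normA.
have in_n s : rho s \in iota 0 n.+1 by rewrite mem_iota ltnS rho_le_n.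
have A1 s : rm_inc A s s = 1.
  by have /andP[/eqP A1 _] := normA _ (in_n s); rewrite /rm_inc A1 zpoly_val1.
have szA s t : (s < t)%O -> (2 * (size (rm_inc A s t)).-1 < rk rho s t)%N.
  move=> /rho_lt lt_st; have /andP[_ /allP] := normA _ (in_n t).
  move=> /(_ (rho s)); rewrite mem_iota lt_st => /(_ isT).
  by have := size_zpoly_val (A (rho s) (rho t)); rewrite /rm_inc /rk; lia.
split=> // s t; rewrite le_eqVlt => /predU1P[->|/szA]; last lia.
by rewrite A1 size_poly1.
Qed.

Hypothesis check : rm_check.

Lemma eulerian_rm : eulerian rho.
Proof.
case/andP: check => /andP[/andP[/andP[zm mz] _] _] _.
exists (rm_inc rm_mobius).
  have zetaE : eq_inc (@zeta _ P) (rm_inc rm_zeta).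
    by move=> s t _; rewrite /rm_inc zpoly_val1.
  by split; [apply: rm_mulP zm | apply: rm_mulP mz] => //; exact: rm_inc_one.
move=> s t _; rewrite /rm_inc /rm_mobius /rk -signr_odd.
by case: odd; rewrite ?zpoly_valN1 ?zpoly_val1.
Qed.

Lemma chow_function_rm : chow_function rho (rm_inc rm_chow).
Proof.
case/andP: check => /andP[/andP[_ /andP[kH Hk]] _] _.
by split; [apply: rm_mulP kH | apply: rm_mulP Hk];
  auto using rm_inc_one, rm_inc_opp, rm_inc_reduced_kernel.
Qed.

Lemma right_kls_rm : right_kls rho (rm_inc rm_right_kls).
Proof.
case/andP: check => /andP[_ /andP[/rm_kls_normalizedP normf fE]] _.
split=> // s t le_st; rewrite rm_inc_rev // (rm_eqP fE) // -mul_rm_inc //.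
by apply: eq_mul_inc => // u v le_uv; rewrite rm_inc_kernel.
Qed.

Lemma left_kls_rm : left_kls rho (rm_inc rm_left_kls).
Proof.
case/andP: check => _ /andP[/rm_kls_normalizedP normg gE].
split=> // s t le_st; rewrite rm_inc_rev // (rm_eqP gE) // -mul_rm_inc //.
by apply: eq_mul_inc => // u v le_uv; rewrite rm_inc_kernel.
Qed.

Hypothesis rho_bot : rho \bot%O = 0%N.
Hypothesis rho_top : rho \top%O = n.

Lemma chow_polynomial_rm :
  chow_polynomial rho (zpoly_val (rm_chow 0 n)).
Proof.
exists (rm_inc rm_chow); first exact: chow_function_rm.
by rewrite /rm_inc rho_bot rho_top.
Qed.

Lemma right_augmented_chow_polynomial_rm :
  right_augmented_chow_polynomial rho
    (zpoly_val (rm_mul rm_chow (rm_rev rm_right_kls) 0 n)).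
Proof.
exists (rm_inc rm_chow), (rm_inc rm_right_kls).
split; [exact: chow_function_rm | exact: right_kls_rm |].
transitivity (rm_inc (rm_mul rm_chow (rm_rev rm_right_kls)) \bot%O \top%O).
  by rewrite /rm_inc rho_bot rho_top.
rewrite -mul_rm_inc ?le0x //.
by apply: eq_mul_inc; rewrite ?le0x // => s t le_st; rewrite rm_inc_rev.
Qed.

Lemma left_augmented_chow_polynomial_rm :
  left_augmented_chow_polynomial rho
    (zpoly_val (rm_mul (rm_rev rm_left_kls) rm_chow 0 n)).
Proof.
exists (rm_inc rm_chow), (rm_inc rm_left_kls).
split; [exact: chow_function_rm | exact: left_kls_rm |].
transitivity (rm_inc (rm_mul (rm_rev rm_left_kls) rm_chow) \bot%O \top%O).
  by rewrite /rm_inc rho_bot rho_top.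
rewrite -mul_rm_inc ?le0x //.
by apply: eq_mul_inc; rewrite ?le0x // => s t le_st; rewrite rm_inc_rev.
Qed.

End RankMatrices.

Lemma zpoly_neg_coef p k :
  Z.ltb (nth Z0 p k) Z0 -> has_negative_coefficient (zpoly_val p).
Proof. by exists k; rewrite coef_zpoly_val; case: (nth _ _ _) H. Qed.

(** * Posets of labelled ranks *)

(** [(a, b, e)] is the interval of ranks from a to b, with e + 1 colours;
    counting the colours in excess of 1 ensures that there is at least one. *)
Definition band := (nat * nat * nat)%type.

Definition band_extra (b : band) : nat := b.2.

Section BandPoset.

Variables (n : nat) (bands : seq band).

(** The extreme ranks are excluded, whatever the band, so that there is one
    element of rank 0 and one of rank n. *)
Definition in_band (b : band) (r : nat) : bool :=
  (0 < r < n)%N && (b.1.1 <= r <= b.1.2)%N.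

Definition band_nth (k : 'I_(size bands)) : band := tnth (in_tuple bands) k.

Definition max_extra : nat := \max_k band_extra (band_nth k).

Definition labelling := {ffun 'I_(size bands) -> 'I_max_extra.+1}.

(** Colour of an element of rank r for the band number k: the value is a dummy
    [ord0] when the band does not contain r, which makes elements with equal
    ranks and equal colours equal. *)
Definition valid_label (r : nat) (k : 'I_(size bands)) :
  pred 'I_max_extra.+1 :=
  fun v => if in_band (band_nth k) r then (v <= band_extra (band_nth k))%N
           else v == ord0.

Definition valid_element (x : 'I_n.+1 * labelling) : bool :=
  [forall k, valid_label x.1 k (x.2 k)].

Definition band_poset := {x | valid_element x}.

HB.instance Definition _ := [Finite of band_poset by <:].

Implicit Types s t u w : band_poset.

Definition band_rank s : nat := (val s).1.

Definition label s : labelling := (val s).2.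

(** No separate case for s = t: elements of equal ranks that agree on all bands
    containing this rank are equal ([band_eq]). *)
Definition band_le s t : bool :=
  (band_rank s <= band_rank t)%N &&
  [forall k, in_band (band_nth k) (band_rank s) &&
             in_band (band_nth k) (band_rank t) ==> (label s k == label t k)].

Lemma band_leP s t :
  reflect ((band_rank s <= band_rank t)%N /\
           forall k, in_band (band_nth k) (band_rank s) ->
             in_band (band_nth k) (band_rank t) -> label s k = label t k)
          (band_le s t).
Proof.
apply: (iffP andP) => [[le_st /forallP eq_st]|[le_st eq_st]]; split=> //.
  by move=> k ks kt; have := eq_st k; rewrite ks kt => /eqP.
by apply/forallP=> k; apply/implyP=> /andP[ks kt]; rewrite eq_st.
Qed.

Lemma valid_labelP s k : valid_label (band_rank s) k (label s k).
Proof. exact: (forallP (valP s)). Qed.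

Lemma label_out s k : ~~ in_band (band_nth k) (band_rank s) -> label s k = ord0.
Proof.
by have := valid_labelP s k; rewrite /valid_label => /[swap] /negPf -> /eqP.
Qed.

Lemma band_eq s t : band_rank s = band_rank t ->
    (forall k, in_band (band_nth k) (band_rank s) -> label s k = label t k) ->
  s = t.
Proof.
move=> eq_r eq_l; apply/val_inj; rewrite [val s]surjective_pairing.
rewrite [val t]surjective_pairing; congr (_, _); first exact/val_inj.
apply/ffunP=> k; have [/eq_l //|out_s] := boolP (in_band (band_nth k) (band_rank s)).
by rewrite -/(label s) -/(label t) !label_out -?eq_r.
Qed.

Fact band_le_refl : reflexive band_le.
Proof. by move=> s; apply/band_leP. Qed.

Fact band_le_anti : antisymmetric band_le.
Proof.
move=> s t /andP[/band_leP[le_st eq_st] /band_leP[le_ts _]].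
have eq_r : band_rank s = band_rank t by lia.
by apply: band_eq => // k ks; rewrite eq_st // -eq_r.
Qed.

Fact band_le_trans : transitive band_le.
Proof.
move=> t s u /band_leP[le_st eq_st] /band_leP[le_tu eq_tu].
apply/band_leP; split=> [|k ks ku]; first exact: leq_trans le_tu.
(* bands are convex: this is what makes the order transitive *)
have kt : in_band (band_nth k) (band_rank t).
  by move: ks ku; rewrite /in_band; lia.
by rewrite eq_st ?eq_tu.
Qed.

Definition band_display : Order.disp_t := Order.Disp tt tt.

HB.instance Definition _ := Order.Le_isPOrder.Build band_display band_poset
  band_le_refl band_le_anti band_le_trans.

Fact valid_extremum (r : 'I_n.+1) :
  ~~ (0 < r < n)%N -> valid_element (r, [ffun=> ord0]).
Proof.
move=> /negPf out; apply/forallP=> k.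
by rewrite /valid_label /in_band /= out ffunE.
Qed.

Fact ord0_extremal : ~~ (0 < @ord0 n < n)%N. Proof. by []. Qed.
Fact ord_max_extremal : ~~ (0 < @ord_max n < n)%N. Proof. by rewrite ltnn andbF. Qed.

Definition band_bot : band_poset := exist (fun x => is_true (valid_element x)) _ (valid_extremum ord0_extremal).
Definition band_top : band_poset := exist (fun x => is_true (valid_element x)) _ (valid_extremum ord_max_extremal).

Fact band_bot_le s : (band_bot <= s)%O.
Proof. by apply/band_leP; split. Qed.

Fact band_le_top s : (s <= band_top)%O.
Proof.
apply/band_leP; split=> [|k _]; first exact: leq_ord.
by rewrite /in_band ltnn andbF.
Qed.

HB.instance Definition _ :=
  Order.hasBottom.Build band_display band_poset band_bot_le.
HB.instance Definition _ :=
  Order.hasTop.Build band_display band_poset band_le_top.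

Lemma band_rank_bot : band_rank \bot%O = 0%N.
Proof. by []. Qed.

Lemma band_rank_top : band_rank \top%O = n.
Proof. by []. Qed.

Lemma band_rank_le_n s : (band_rank s <= n)%N.
Proof. exact: leq_ord. Qed.

Lemma band_rank_lt s t : (s < t)%O -> (band_rank s < band_rank t)%N.
Proof.
rewrite lt_neqAle => /andP[neq_st /band_leP[le_st eq_st]].
rewrite ltn_neqAle le_st andbT; apply: contraNneq neq_st => eq_r.
by apply/eqP/band_eq => // k ks; rewrite eq_st // -eq_r.
Qed.

Definition band_factor (i r j : nat) (b : band) : nat :=
  if [&& in_band b r, ~~ in_band b i & ~~ in_band b j]
  then (band_extra b).+1 else 1.

(** The colours for band k of the elements of rank r in [s, t].  They can be
    chosen independently for the different bands, hence the product formula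
    [card_rank_band]. *)
Definition between_label s t (r : nat) (k : 'I_(size bands)) :
  pred 'I_max_extra.+1 :=
  fun v => [&& valid_label r k v,
    in_band (band_nth k) (band_rank s) && in_band (band_nth k) r
      ==> (label s k == v) &
    in_band (band_nth k) r && in_band (band_nth k) (band_rank t)
      ==> (v == label t k)].

Lemma card_between_label s t r k : (s <= t)%O ->
    (band_rank s <= r <= band_rank t)%N ->
  #|between_label s t r k| =
    band_factor (band_rank s) r (band_rank t) (band_nth k).
Proof.
move=> /band_leP[_ /(_ k) eq_st] r_bnd.
rewrite /band_factor; set b := band_nth k in eq_st *.
have := valid_labelP s k; have := valid_labelP t k.
rewrite /between_label /valid_label -/b.
have [br|br] := boolP (in_band b r); last first.
  move=> _ _; rewrite andFb -[RHS](card1 (@ord0 max_extra)); apply: eq_card => v.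
  by rewrite /in_mem /= andbF /= andbT.
have [bs|bs] := boolP (in_band b (band_rank s)).
  move=> _ s_le; rewrite /= -[RHS](card1 (label s k)); apply: eq_card => v.
  rewrite /in_mem /= (eq_sym _ v).
  have [->|] := eqVneq v (label s k); rewrite ?andbF //= s_le /=.
  by apply/implyP=> bt; rewrite eq_st.
have [bt|bt] := boolP (in_band b (band_rank t)).
  move=> t_le _; rewrite /= -[RHS](card1 (label t k)); apply: eq_card => v.
  rewrite /in_mem /=.
  by have [->|] := eqVneq v (label t k); rewrite ?andbF //= t_le.
move=> _ _ /=.
have le_bm : (band_extra b < max_extra.+1)%N by rewrite ltnS; exact: leq_bigmax.
transitivity #|[pred v : 'I_max_extra.+1 | (v < (band_extra b).+1)%N]|.
  by apply: eq_card => v; rewrite !inE /in_mem /= !andbT.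
by rewrite -sum1_card (big_ord_narrow le_bm) sum1_card card_ord.
Qed.

Lemma card_rank_band s t r : (s <= t)%O ->
    (band_rank s <= r <= band_rank t)%N ->
  #|[set w : band_poset | (s <= w <= t)%O && (band_rank w == r)]| =
    (\prod_(b <- bands) band_factor (band_rank s) r (band_rank t) b)%N.
Proof.
move=> le_st r_bnd.
have r_lt : (r < n.+1)%N by have := band_rank_le_n t; lia.
transitivity #|family (between_label s t r)|; last first.
  rewrite card_family foldrE big_map big_enum /= [RHS]big_tnth.
  by apply: eq_bigr => k _; rewrite card_between_label.
rewrite -(card_in_imset (f := label)); last first.
  move=> u w; rewrite !inE => /andP[_ /eqP ur] /andP[_ /eqP wr] eq_l.
  by apply: band_eq => [|k _]; rewrite ?ur ?wr ?eq_l.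
apply: eq_card => x; apply/imsetP/familyP => [[w + ->] k|x_fam].
  rewrite inE => /andP[/andP[/band_leP[_ sw] /band_leP[_ wt]] /eqP wr].
  rewrite /in_mem /= /between_label -wr valid_labelP /=.
  by apply/andP; split; apply/implyP=> /andP[k1 k2]; rewrite (sw, wt).
have x_ok : valid_element (Ordinal r_lt, x).
  by apply/forallP=> k; have /and3P[] := x_fam k.
exists (exist (fun y => is_true (valid_element y)) _ x_ok) => //.
have [le_sr le_rt] := andP r_bnd.
rewrite inE eqxx andbT; apply/andP; split; apply/band_leP; split=> // k k1 k2.
  by have /and3P[_ + _] := x_fam k; rewrite k1 k2 => /eqP.
by have /and3P[_ _] := x_fam k; rewrite k1 k2 => /eqP.
Qed.

(** A cover raises the rank by exactly 1, since by [card_rank_band] an interval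
    contains elements of all the intermediate ranks. *)
Lemma band_rank_function : rank_function band_rank.
Proof.
have step s t : covers s t -> band_rank t = (band_rank s).+1.
  move=> /andP[lt_st /forallP no_between]; have lt_r := band_rank_lt lt_st.
  apply/eqP; rewrite eqn_leq lt_r andbT leqNgt; apply/negP=> gap.
  have := @card_rank_band s t (band_rank s).+1 (ltW lt_st); rewrite lt_r leqnSn.
  move=> /(_ isT) card_w.
  have: (0 < #|[set w | (s <= w <= t)%O && (band_rank w == (band_rank s).+1)]|)%N.
    by rewrite card_w prodn_gt0 // => b; rewrite /band_factor; case: ifP.
  case/card_gt0P=> w; rewrite inE => /andP[/andP[le_sw le_wt] /eqP wr].
  have := no_between w; rewrite !lt_neqAle le_sw le_wt !andbT negb_and !negbK.
  by case/orP=> /eqP/(congr1 band_rank); lia.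
move=> p; rewrite -[size p]add0n -band_rank_bot.
elim: p \bot%O => [|t p IHp] s /=; first by rewrite addn0.
by case/andP=> /step st /IHp ->; rewrite st addSnnS.
Qed.

Definition band_count (i r j : nat) : Z :=
  foldr (fun b => Z.mul (Z.of_nat (band_factor i r j b))) (Zpos xH) bands.

Lemma band_countE i r j :
  (\prod_(b <- bands) band_factor i r j b)%N%:Z = int_of_Z (band_count i r j).
Proof.
rewrite /band_count; elim: bands => [|b bs IHb]; first by rewrite big_nil.
rewrite big_cons PoszM IHb /= (rmorphM int_of_Z (Z.of_nat _)).
by congr (_ * _); case: band_factor => //= m; lia.
Qed.

End BandPoset.

(** * A poset with negative coefficients *)

(** The three long bands cross, meeting in [3,4] and [7,8]; the bands and these
    intersections have even length, which makes the poset Eulerian. *)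
Definition bands11 : seq band :=
  [:: (1, 4, 299); (3, 8, 299); (7, 10, 299)] ++
  [seq (r, r, 1) | r <- iota 1 10].

Lemma bands11_check : rm_check 11 (band_count 11 bands11).
Proof. by vm_compute. Qed.

Lemma bands11_chow_neg :
  Z.ltb (nth Z0 (rm_chow 11 (band_count 11 bands11) 0 11) 4) Z0.
Proof. by vm_compute. Qed.

Lemma bands11_right_neg :
  let cnt := band_count 11 bands11 in
  Z.ltb (nth Z0 (rm_mul cnt (rm_chow 11 cnt) (rm_rev (rm_right_kls 11 cnt))
                        0 11) 4) Z0.
Proof. by vm_compute. Qed.

Lemma bands11_left_neg :
  let cnt := band_count 11 bands11 in
  Z.ltb (nth Z0 (rm_mul cnt (rm_rev (rm_left_kls 11 cnt)) (rm_chow 11 cnt)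
                        0 11) 4) Z0.
Proof. by vm_compute. Qed.

Theorem theorem7p1 :
  exists (d : Order.disp_t) (P : finTBPOrderType d) (rho : P -> nat),
    [/\ rank_function rho,
        eulerian rho &
        exists pH pF pG : {poly int},
          [/\ chow_polynomial rho pH,
              right_augmented_chow_polynomial rho pF,
              left_augmented_chow_polynomial rho pG &
              [/\ has_negative_coefficient pH,
                  has_negative_coefficient pF &
                  has_negative_coefficient pG]]].
Proof.
pose P : finTBPOrderType band_display := band_poset 11 bands11.
pose rho : P -> nat := @band_rank 11 bands11.
have rho_le_n (s : P) : (rho s <= 11)%N by exact: band_rank_le_n.
have rho_lt (s t : P) : (s < t)%O -> (rho s < rho t)%N by exact: band_rank_lt.
have rho_bot : rho \bot%O = 0%N by exact: band_rank_bot.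
have rho_top : rho \top%O = 11%N by exact: band_rank_top.
have card_rank (s t : P) r : (s <= t)%O -> (rho s <= r <= rho t)%N ->
    #|[set w : P | (s <= w <= t)%O && (rho w == r)]|%:Z =
    int_of_Z (band_count 11 bands11 (rho s) r (rho t)).
  by move=> le_st r_bnd; rewrite -band_countE -card_rank_band.
have check := bands11_check.
exists band_display, P, rho; split; first exact: band_rank_function.
  exact: eulerian_rm rho_le_n rho_lt card_rank check.
exists (zpoly_val (rm_chow 11 (band_count 11 bands11) 0 11)).
eexists; eexists; split.
- exact: chow_polynomial_rm rho_le_n rho_lt card_rank check rho_bot rho_top.
- exact: (right_augmented_chow_polynomial_rm rho_le_n rho_lt card_rank check
            rho_bot rho_top).
- exact: (left_augmented_chow_polynomial_rm rho_le_n rho_lt card_rank check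
            rho_bot rho_top).
split; [exact: zpoly_neg_coef bands11_chow_neg |
        exact: zpoly_neg_coef bands11_right_neg |
        exact: zpoly_neg_coef bands11_left_neg].
Qed.
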